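(* Fix a real number $p\in(0,1)$ and an integer $k\geqslant 1$. For each $n$, let $G_n\sim\mathbb{G}(n,p)$. Then $$\alpha_k(G_n)=\big(2+o(1)\big)\log_{\frac{1}{1-p}} n$$ with high probability; that is, for every $\epsilon>0$, $$\lim_{n\to\infty}\mathbb{P}\left(\left|\frac{\alpha_k(G_n)}{\log_{\frac{1}{1-p}} n}-2\right|\leqslant\epsilon\right)=1.$$
   Context: $\mathbb{G}(n,p)$ denotes the Erdős–Rényi random graph: the probability space of all simple graphs on a fixed vertex set of size $n$ in which each pair of distinct vertices is adjacent independently with probability $p$. For a graph $G$ and a nonnegative integer $k$, a set $S\subseteq V(G)$ is called $k$-independent if the induced subgraph $G[S]$ has maximum degree at most $k$; the $k$-independence number $\alpha_k(G)$ is the maximum cardinality of a $k$-independent set in $G$ (so $\alpha_0(G)$ is the usual independence number). *)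

(* Defs.v *)
From HB Require Import structures.
From mathcomp Require Import all_boot all_order all_algebra.
From mathcomp Require Import all_classical all_reals all_analysis.

Set Implicit Arguments.
Unset Strict Implicit.
Unset Printing Implicit Defensive.

Import Order.TTheory GRing.Theory Num.Theory.
Import numFieldNormedType.Exports.

Local Open Scope ring_scope.
Local Open Scope set_scope.

Definition vpairs (T : finType) : {set {set T}} := [set e : {set T} | #|e| == 2].

Record sgraph (T : finType) := SGraph {
  edges : {set {set T}};
  edges_vpairs : edges \subset vpairs T
}.

HB.instance Definition _ (T : finType) := [isSub for @edges T].
HB.instance Definition _ (T : finType) := [Finite of sgraph T by <:].

Definition adj (T : finType) (G : sgraph T) : rel T :=
  fun x y => [set x; y] \in edges G.

Lemma adj_sym (T : finType) (G : sgraph T) : symmetric (adj G).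
Proof. by move=> x y; rewrite /adj finset.setUC. Qed.

Lemma adj_irrefl (T : finType) (G : sgraph T) : irreflexive (adj G).
Proof.
move=> x; apply/negP; rewrite /adj finset.setUid => /(fintype.subsetP (edges_vpairs G)).
by rewrite inE cards1.
Qed.

Definition induced_deg (T : finType) (G : sgraph T) (S : {set T}) (x : T) : nat :=
  #|[set y in S | adj G x y]|.

Definition induced_maxdeg (T : finType) (G : sgraph T) (S : {set T}) : nat :=
  \max_(x in S) induced_deg G S x.

Definition kindep (T : finType) (k : nat) (G : sgraph T) : pred {set T} :=
  fun S => (induced_maxdeg G S <= k)%N.

Definition alphak (T : finType) (k : nat) (G : sgraph T) : nat :=
  \max_(S : {set T} | kindep k G S) #|S|.

(* Each of the pairs of distinct vertices contributes, independently, a factor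
   p when it is an edge of G and 1 - p when it is not. *)
Definition gnp_weight (R : realType) (p : R) (T : finType) (G : sgraph T) : R :=
  \prod_(e in vpairs T) (if e \in edges G then p else 1 - p).

Definition gnp_prob (R : realType) (p : R) (T : finType) (A : pred (sgraph T)) : R :=
  \sum_(G : sgraph T | A G) gnp_weight p G.

(* The joint law of the edge indicators: any set D of pairs is simultaneously
   present with probability p ^+ #|D|.  In particular (D empty) the total mass
   is 1, and the edge events are mutually independent of probability p. *)
Lemma gnp_prob_edges (R : realType) (p : R) (T : finType) (D : {set {set T}}) :
  D \subset vpairs T ->
  gnp_prob p (fun G : sgraph T => D \subset edges G) = p ^+ #|D|.
Proof.
move=> DP; rewrite /gnp_prob /gnp_weight.
transitivity (\sum_(E : {set {set T}} | (E \subset vpairs T) && (D \subset E))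
    \prod_(e in vpairs T) (if e \in E then p else 1 - p)).
  rewrite [RHS](reindex_omap (@edges T) insub) => /=; last first.
    by move=> E /andP[EP _]; rewrite insubT.
  apply: eq_bigl => G; rewrite (edges_vpairs G) /=.
  by rewrite (valK G : insub (edges G) = Some G) eqxx andbT.
pose F (e : {set T}) : R := if e \in vpairs T then p else 0.
pose H (e : {set T}) : R :=
  if e \in vpairs T then (if e \in D then 0 else 1 - p) else 1.
transitivity (\prod_(e : {set T}) (F e + H e)); last first.
  rewrite -prodr_const [RHS]big_mkcond; apply: eq_bigr => e _.
  rewrite /F /H; case: ifP => eP; case: ifP => eD.
  - by rewrite addr0.
  - by rewrite addrC subrK.
  - by rewrite (fintype.subsetP DP e eD) in eP.
  - by rewrite add0r.
rewrite bigA_distr big_mkcond; apply: eq_bigr => E _.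
case: ifPn => [/andP[EP DE]|].
  rewrite big_mkcond; apply: eq_bigr => e _; rewrite /F /H.
  case: (boolP (e \in vpairs T)) => eP; case: (boolP (e \in E)) => eE //.
  - by rewrite (contraNF (fintype.subsetP DE e) eE).
  - by rewrite (fintype.subsetP EP e eE) in eP.
rewrite negb_and => /orP[] /fintype.subsetPn[e e1 e2].
  by rewrite (bigD1 e) //= e1 /F (negbTE e2) mul0r.
by rewrite (bigD1 e) //= (negbTE e2) /H e1 (fintype.subsetP DP e e1) mul0r.
Qed.

Definition logb (R : realType) (b x : R) : R := ln x / ln b.

(* Main.v *)
(* Upper tail: a k-independent set of size s spans at most k s edges. For a
   constant 0 < x <= 1 the mean of x ^ (number of edges inside a fixed s-set) is
   (p x + 1 - p) ^ C(s, 2), so Markov's inequality and a union bound show that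
   some s-set is k-independent with probability at most
   (n (p x + 1 - p) ^ ((s - 1) / 2) / x ^ k) ^ s; for s above (2 + eps) log n
   and x small enough this tends to 0. Lower tail: an independent set is
   k-independent, and the second moment method applies to the number of
   independent s-sets with s about (2 - eps) log n; the relative variance is at
   most (1 + a) ^ s - 1 with a = s (1 - p) ^ (- (s - 1) / 2) / n. *)
Require Import Defs.
From HB Require Import structures.
From mathcomp Require Import all_boot all_order all_algebra.
From mathcomp Require Import all_classical all_reals all_analysis.
From mathcomp Require Import ring lra zify.

Import Order.TTheory GRing.Theory Num.Theory.
Import numFieldNormedType.Exports.

Local Open Scope ring_scope.

(** * Products expanded over subsets *)

Lemma sum_subset_prod (R : comPzRingType) (U : finType) (D : {set U})
    (f : U -> bool -> R) :
  \sum_(E : {set U} | E \subset D) \prod_(e in D) f e (e \in E)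
  = \prod_(e in D) (f e true + f e false).
Proof.
(* Outside [D] the values 0 and 1 make every [E] not contained in [D] vanish from the expansion over
   the whole type. *)
pose F e : R := if e \in D then f e true else 0.
pose H e : R := if e \in D then f e false else 1.
transitivity (\prod_e (F e + H e)); last first.
  rewrite [RHS]big_mkcond; apply: eq_bigr => e _.
  by rewrite /F /H; case: ifP => // _; rewrite add0r.
rewrite bigA_distr big_mkcond; apply: eq_bigr => E _.
case: ifPn => [/fintype.subsetP ED|/fintype.subsetPn[e eE eD]]; last first.
  by rewrite (bigD1 e) //= eE /F (negbTE eD) mul0r.
rewrite big_mkcond; apply: eq_bigr => e _; rewrite /F /H.
by case: ifPn => eD; case: ifPn => // eE; rewrite ED in eD.
Qed.

(** The binomial theorem indexed by sets; it recombines the overlap sum of the second moment. *)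
Lemma sum_subset_expr_card (R : comPzRingType) (U : finType) (D : {set U})
    (a : R) :
  \sum_(E : {set U} | E \subset D) a ^+ #|E| = (1 + a) ^+ #|D|.
Proof.
rewrite -prodr_const.
under [RHS]eq_bigr => e _ do rewrite addrC.
rewrite -(@sum_subset_prod _ _ D (fun _ b => if b then a else 1)).
apply: eq_bigr => E ED; rewrite -big_mkcondr -prodr_const /=.
apply: eq_bigl => e; apply/idP/andP => [eE|[]//]; split=> //.
exact: (fintype.subsetP ED).
Qed.

(** * Edge generating function and elementary probability in the random graph *)

Section RandomGraph.
Variables (R : realType) (p : R) (T : finType).
Implicit Types (G : sgraph T) (S I : {set T}) (D : {set {set T}}).

Lemma sum_sgraph (F : {set {set T}} -> R) :
  \sum_(G : sgraph T) F (edges G)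
  = \sum_(E : {set {set T}} | E \subset vpairs T) F E.
Proof.
rewrite [RHS](reindex_omap (@edges T) insub) => /=; last first.
  by move=> E EP; rewrite insubT.
apply: eq_bigl => G; rewrite (edges_vpairs G) /=.
by rewrite (valK G : insub (edges G) = Some G) eqxx.
Qed.

(** Independence of the pairs factors the sum: a pair of [D] gives [p * x + (1 - p)], any other pair
    gives 1. Taking [x = 1] yields the total mass, and [x = 0] the probability that [D] contains no
    edge. *)
Lemma gnp_generating_function D (x : R) : D \subset vpairs T ->
  \sum_(G : sgraph T) gnp_weight p G * x ^+ #|D :&: edges G|
  = (p * x + (1 - p)) ^+ #|D|.
Proof.
move=> DP.
pose f (e : {set T}) (b : bool) : R :=
  (if b then p else 1 - p) * (if (e \in D) && b then x else 1).
rewrite (sum_sgraph (fun E =>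
  (\prod_(e in vpairs T) (if e \in E then p else 1 - p)) * x ^+ #|D :&: E|)).
transitivity (\prod_(e in vpairs T) (f e true + f e false)); last first.
  rewrite -prodr_const (bigID (fun e => e \in D)) /= [X in _ * X]big1 => [|e].
    rewrite mulr1; apply: eq_big => [e|e /andP[_ eD]].
      by apply/andP/idP => [[]//|eD]; split=> //; apply: (fintype.subsetP DP).
    by rewrite /f eD /= mulr1.
  by move=> /andP[_ /negbTE eD]; rewrite /f eD /= !mulr1 addrC subrK.
rewrite -sum_subset_prod; apply: eq_bigr => E EP.
rewrite big_split /=; congr (_ * _).
rewrite -prodr_const -big_mkcondr /=; apply: eq_bigl => e.
rewrite inE; apply/idP/andP => [/andP[eD eE]|[]//].
by rewrite (fintype.subsetP DP) // eD eE.
Qed.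

Hypothesis hp : 0 < p < 1.

Lemma gnp_weight_ge0 G : 0 <= gnp_weight p G.
Proof.
case/andP: hp => p0 p1.
by apply: prodr_ge0 => e _; case: ifP => _; lra.
Qed.

Lemma gnp_prob_total : \sum_(G : sgraph T) gnp_weight p G = 1.
Proof.
rewrite -[RHS](expr0 (p * 1 + (1 - p))) -(finset.cards0 {set T}).
rewrite -gnp_generating_function ?finset.sub0set //.
by apply: eq_bigr => G _; rewrite expr1n mulr1.
Qed.

Lemma gnp_prob_ge0 (A : pred (sgraph T)) : 0 <= gnp_prob p A.
Proof. by apply: sumr_ge0 => G _; exact: gnp_weight_ge0. Qed.

Lemma gnp_probC (A : pred (sgraph T)) :
  gnp_prob p A + gnp_prob p (predC A) = 1.
Proof. by rewrite -gnp_prob_total [RHS](bigID A). Qed.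

Lemma gnp_prob_le1 (A : pred (sgraph T)) : gnp_prob p A <= 1.
Proof. by rewrite -(gnp_probC A) lerDl gnp_prob_ge0. Qed.

Lemma gnp_prob_mono (A B : pred (sgraph T)) :
  (forall G, A G -> B G) -> gnp_prob p A <= gnp_prob p B.
Proof.
move=> AB; rewrite /gnp_prob big_mkcond [leRHS]big_mkcond.
apply: ler_sum => G _.
case: ifPn => [/AB ->//|_]; case: ifP => // _; exact: gnp_weight_ge0.
Qed.

Lemma gnp_prob_leU (A B C : pred (sgraph T)) :
  (forall G, A G -> B G || C G) ->
  gnp_prob p A <= gnp_prob p B + gnp_prob p C.
Proof.
move=> ABC; rewrite /gnp_prob [in leLHS]big_mkcond [X in _ <= X + _]big_mkcond.
rewrite [X in _ <= _ + X]big_mkcond -big_split; apply: ler_sum => G _ /=.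
have := ABC G; have := gnp_weight_ge0 G.
by case: (A G); case: (B G); case: (C G) => //= w0 ABCG;
  rewrite ?addr0 ?add0r ?lerDl ?lexx ?addr_ge0 //; have := ABCG isT.
Qed.

Lemma markov_gnp (A : pred (sgraph T)) (F : sgraph T -> R) :
  (forall G, 0 <= F G) -> (forall G, A G -> 1 <= F G) ->
  gnp_prob p A <= \sum_(G : sgraph T) gnp_weight p G * F G.
Proof.
move=> F0 F1; rewrite /gnp_prob big_mkcond; apply: ler_sum => G _.
case: ifPn => [/F1 FG|_]; last by rewrite mulr_ge0 ?gnp_weight_ge0.
by rewrite ler_peMr ?gnp_weight_ge0.
Qed.

End RandomGraph.

(** * Edges spanned by k-independent sets *)

Section PairsIn.
Variable T : finType.
Implicit Types (G : sgraph T) (S I : {set T}).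

Definition pairs_in S : {set {set T}} :=
  [set e : {set T} | (e \subset S) && (#|e| == 2)].

Lemma pairs_in_vpairs S : pairs_in S \subset vpairs T.
Proof. by apply/fintype.subsetP => e; rewrite !inE => /andP[]. Qed.

Lemma card_pairs_in S : #|pairs_in S| = 'C(#|S|, 2).
Proof. exact: cards_draws. Qed.

Lemma pairs_inI S1 S2 : pairs_in S1 :&: pairs_in S2 = pairs_in (S1 :&: S2).
Proof.
by apply/setP => e; rewrite !inE finset.subsetI; case: (#|e| == 2);
  rewrite ?andbT ?andbF.
Qed.

Lemma card_pairs_inU S1 S2 :
  (#|pairs_in S1 :|: pairs_in S2| + 'C(#|S1 :&: S2|, 2)
   = 'C(#|S1|, 2) + 'C(#|S2|, 2))%N.
Proof. by rewrite -!card_pairs_in -pairs_inI cardsUI. Qed.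

Lemma induced_deg_kindep k G S x :
  kindep k G S -> x \in S -> (induced_deg G S x <= k)%N.
Proof. by move=> Sk xS; apply: leq_trans Sk; exact: leq_bigmax_cond. Qed.

Lemma kindep_sub k G S I : I \subset S -> kindep k G S -> kindep k G I.
Proof.
move=> IS Sk; apply/bigmax_leqP => x xI.
apply: leq_trans (induced_deg_kindep k G S x Sk (fintype.subsetP IS _ xI)).
apply: subset_leq_card; apply/fintype.subsetP => y.
rewrite !inE => /andP[yI ->].
by rewrite (fintype.subsetP IS).
Qed.

(** Each edge inside [S] occurs among the arcs leaving an endpoint in [S], and every vertex of [S]
    has at most [k] such arcs. *)
Lemma kindep_edges k G S :
  kindep k G S -> (#|pairs_in S :&: edges G| <= k * #|S|)%N.
Proof.
move=> Sk.
pose arcs := \bigcup_(x in S) [set [set x; y] | y in [set y in S | adj G x y]].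
have sub : pairs_in S :&: edges G \subset arcs.
  apply/fintype.subsetP => e; rewrite !inE.
  move=> /andP[/andP[eS /cards2P[x [y [xy ee]]]] eG].
  rewrite ee in eS eG *; have [xS yS] : x \in S /\ y \in S.
    by split; apply: (fintype.subsetP eS); rewrite !inE eqxx ?orbT.
  apply/finset.bigcupP; exists x => //.
  by apply/imsetP; exists y; rewrite ?inE ?yS.
apply: leq_trans (subset_leq_card sub) _.
rewrite [leqRHS]mulnC -sum_nat_const /arcs.
elim/big_rec2: _ => [|x n A xS IH]; first by rewrite finset.cards0.
apply: leq_trans (leq_card_setU _ _).1 _; apply: leq_add IH.
exact: leq_trans (leq_imset_card _ _) (induced_deg_kindep k G S x Sk xS).
Qed.

Lemma kindep_no_edges k G S :
  pairs_in S :&: edges G = finset.set0 -> kindep k G S.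
Proof.
move=> S0; apply/bigmax_leqP => x xS; rewrite /induced_deg.
suff -> : [set y in S | adj G x y] = finset.set0 by rewrite finset.cards0.
apply/setP => y; rewrite !inE; apply/negP => /andP[yS xy].
suff : [set x; y] \in pairs_in S :&: edges G by rewrite S0 inE.
have neq : x != y by apply: contraTneq xy => ->; rewrite adj_irrefl.
by rewrite !inE [_ \in edges G]xy andbT finset.subUset !finset.sub1set xS yS /=
  cards2 neq.
Qed.

(** A largest k-independent set has a subset of size exactly [s], k-independent by heredity; the
    union bound can then run over sets of one fixed size. *)
Lemma alphak_witness k G s :
  (s <= alphak k G)%N -> exists2 S : {set T}, #|S| = s & kindep k G S.
Proof.
move=> sa.
have k0 : kindep k G finset.set0 by rewrite /kindep /induced_maxdeg big_set0.
have pos : (0 < #|kindep k G|)%N by apply/card_gt0P; exists finset.set0.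
have [S Sk Sa] := eq_bigmax_cond (fun S : {set T} => #|S|) pos.
have : (s <= #|S|)%N by rewrite -Sa.
rewrite -bin_gt0 -cards_draws => /card_gt0P[I].
rewrite inE => /andP[IS /eqP Is].
by exists I => //; exact: kindep_sub IS Sk.
Qed.

Lemma alphak_ge k G S : kindep k G S -> (#|S| <= alphak k G)%N.
Proof. by move=> Sk; exact: leq_bigmax_cond. Qed.

End PairsIn.

(** * Counting estimates *)

Lemma expr_bin2 (R : pzSemiRingType) (t : R) (n : nat) :
  (t ^+ 2) ^+ 'C(n, 2) = (t ^+ n.-1) ^+ n.
Proof. by rewrite -!exprM -mul_bin_diag bin1 mulnC. Qed.

(** The quotient of the two binomials is the product of [(s - j) / (n - j)] over [j < i], and each
    factor is at most [s / n]. *)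
Lemma bin_sub_le (n s i : nat) : (i <= s)%N -> (s <= n)%N ->
  ('C(n - i, s - i) * n ^ i <= 'C(n, s) * s ^ i)%N.
Proof.
move=> + sn; elim: i => [|i IH] is_; first by rewrite !subn0.
have {}IH := IH (ltnW is_).
suff step : ('C(n - i.+1, s - i.+1) * n <= 'C(n - i, s - i) * s)%N.
  rewrite !expnS mulnA (leq_trans (leq_mul step (leqnn _))) //.
  by rewrite mulnAC [(s * _)%N]mulnC mulnA leq_mul2r IH orbT.
have ni : (0 < n - i)%N by lia.
have /= := mul_bin_diag (n - i) (s - i.+1).
rewrite -(leq_pmul2l ni) [(n - i.+1)%N]subnS.
rewrite (_ : (s - i.+1).+1 = (s - i)%N); last by lia.
rewrite !mulnA => ->.
have h : ((s - i) * n <= (n - i) * s)%N.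
  by rewrite !mulnBl [(n * s)%N]mulnC leq_sub2l // leq_mul2l sn orbT.
by rewrite mulnAC [leqRHS]mulnAC leq_mul2r h orbT.
Qed.

(** Removing [I] is injective on the supersets of [I] and lands in the subsets of its complement. *)
Lemma card_supersets (T : finType) (I : {set T}) (s : nat) :
  (#|[set S : {set T} | (I \subset S) && (#|S| == s)]|
   <= 'C(#|T| - #|I|, s - #|I|))%N.
Proof.
have -> : (#|T| - #|I|)%N = #|~: I| by rewrite -(cardsC I) addKn.
rewrite -cards_draws -(card_in_imset (f := fun S => S :\: I)).
  apply: subset_leq_card; apply/fintype.subsetP => _ /imsetP[S + ->].
  rewrite !inE => /andP[IS /eqP Ss].
  rewrite cardsD (finset.setIidPr IS) Ss eqxx andbT.
  by apply/fintype.subsetP => x; rewrite !inE => /andP[].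
move=> S1 S2; rewrite !inE => /andP[IS1 _] /andP[IS2 _] eqS.
by rewrite -(finset.setID S1 I) -(finset.setID S2 I) eqS !(finset.setIidPr _).
Qed.

(** An upper bound [1 / (1 - n a)] for the power, multiplied out so that the sign of [1 - n a] does
    not matter. The induction uses [(1 + a) * (1 - (n + 1) a) <= 1 - n a]. *)
Lemma expr1D_mulB_le1 (R : realFieldType) (a : R) (n : nat) :
  0 <= a -> (1 + a) ^+ n * (1 - n%:R * a) <= 1.
Proof.
move=> a0; elim: n => [|n IH]; first by rewrite expr0 mul0r subr0 mulr1.
apply: le_trans IH; rewrite exprSr -mulrA ler_wpM2l ?exprn_ge0 //; first lra.
have n0 : 0 <= n%:R :> R by [].
by rewrite -natr1; nra.
Qed.

(** * Tail bounds at a fixed size [s] *)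

Section AlphakBounds.
Variables (R : realType) (p : R) (T : finType) (k s : nat).
Hypothesis hp : 0 < p < 1.

Lemma sum_card_const (c : R) :
  \sum_(S : {set T} | #|S| == s) c = 'C(#|T|, s)%:R * c.
Proof.
rewrite -card_draws sumr_const -[LHS]mulr_natl; congr (_%:R * _).
by apply: eq_card => S; rewrite !inE.
Qed.

(* Exponential Markov: a k-independent s-set spans at most k s edges, so
   x ^ (number of edges) is at least x ^ (k s). *)
Lemma alphak_upper_tail (x : R) : 0 < x <= 1 ->
  gnp_prob p (fun G : sgraph T => (s <= alphak k G)%N)
  <= 'C(#|T|, s)%:R * ((p * x + (1 - p)) ^+ 'C(s, 2) / x ^+ (k * s)).
Proof.
move=> /andP[x0 x1].
(* Summing over all s-sets makes a single use of Markov's inequality perform the union bound as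
   well. *)
pose F (G : sgraph T) := \sum_(S : {set T} | #|S| == s)
  x ^+ #|pairs_in T S :&: edges G| / x ^+ (k * s).
have xe m : 0 <= x ^+ m by rewrite exprn_ge0 // ltW.
have F0 G S : 0 <= x ^+ #|pairs_in T S :&: edges G| / x ^+ (k * s).
  by rewrite divr_ge0.
apply: (le_trans (markov_gnp _ _ _ hp _ F _ _)) => [G|G|].
- by apply: sumr_ge0.
- move=> /alphak_witness[S /eqP Ss Sk].
  rewrite /F (bigD1 S) //= -[leLHS]addr0 lerD ?sumr_ge0 //.
  rewrite ler_pdivlMr ?exprn_gt0 // mul1r ler_wiXn2l ?(ltW x0) //.
  by rewrite -[in leqRHS](eqP Ss) kindep_edges.
- under eq_bigr do rewrite mulr_sumr.
  rewrite exchange_big /= -sum_card_const; apply: ler_sum => S /eqP Ss.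
  under eq_bigr do rewrite mulrA.
  rewrite -mulr_suml gnp_generating_function ?pairs_in_vpairs //.
  by rewrite card_pairs_in Ss.
Qed.

Section SecondMoment.
(** With [t] a square root of [1 / (1 - p)], half-integer powers of [1 - p] become integer powers of
    [t]. *)
Variable t : R.
Hypothesis (t1 : 1 <= t) (tp : t ^+ 2 = (1 - p)^-1).
Hypothesis sn : (s <= #|T|)%N.
Hypothesis s0 : (0 < s)%N.

Let q : R := 1 - p.
Let N : nat := 'C(s, 2).
Let n : R := #|T|%:R.
Let a : R := s%:R * t ^+ s.-1 / n.

(** Since [0 ^+ 0 = 1], this is the indicator that [S] is independent, in the form of the generating
    function at [x = 0]. *)
Let free (S : {set T}) (G : sgraph T) : R := 0 ^+ #|pairs_in T S :&: edges G|.
Let X (G : sgraph T) : R := \sum_(S : {set T} | #|S| == s) free S G.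
Let mu : R := 'C(#|T|, s)%:R * q ^+ N.

Let q0 : 0 < q. Proof. by rewrite /q; case/andP: hp => ? ?; lra. Qed.
Let n0 : 0 < n. Proof. by rewrite ltr0n (leq_trans s0). Qed.

Let sum_free (D : {set {set T}}) : D \subset vpairs T ->
  \sum_(G : sgraph T) gnp_weight p G * 0 ^+ #|D :&: edges G| = q ^+ #|D|.
Proof. by move=> DP; rewrite gnp_generating_function // mulr0 add0r. Qed.

Let first_moment : \sum_(G : sgraph T) gnp_weight p G * X G = mu.
Proof.
under eq_bigr do rewrite mulr_sumr.
rewrite exchange_big /mu -sum_card_const; apply: eq_bigr => S /eqP Ss.
by rewrite sum_free ?pairs_in_vpairs // card_pairs_in Ss.
Qed.

Let freeM (S1 S2 : {set T}) (G : sgraph T) :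
  free S1 G * free S2 G = 0 ^+ #|(pairs_in T S1 :|: pairs_in T S2) :&: edges G|.
Proof.
rewrite /free -exprD !expr0n addn_eq0 !cards_eq0 finset.setIUl.
by rewrite finset.setU_eq0.
Qed.

(** Both sets are independent when the union of their pairs has no edge; each shared pair is counted
    once, which gives back a factor [1 / (1 - p) = t ^+ 2]. *)
Let sum_freeM (S1 S2 : {set T}) : #|S1| = s -> #|S2| = s ->
  \sum_(G : sgraph T) gnp_weight p G * (free S1 G * free S2 G)
  = q ^+ N * q ^+ N * (t ^+ 2) ^+ 'C(#|S1 :&: S2|, 2).
Proof.
move=> c1 c2; under eq_bigr do rewrite freeM.
rewrite sum_free ?finset.subUset ?pairs_in_vpairs //.
have := card_pairs_inU T S1 S2; rewrite c1 c2 -exprD => <-.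
by rewrite tp exprD exprVn mulfK // expf_neq0 // gt_eqF.
Qed.

(* Every s-set S2 is charged to all subsets I of S1 it contains, which turns
   the sum over overlaps into a binomial expansion. *)
Let sum_overlap (S1 : {set T}) : #|S1| = s ->
  \sum_(S2 : {set T} | #|S2| == s) (t ^+ 2) ^+ 'C(#|S1 :&: S2|, 2)
  <= 'C(#|T|, s)%:R * (1 + a) ^+ s.
Proof.
move=> c1; have t0 : 0 <= t by apply: le_trans t1.
have tI0 (I : {set T}) : 0 <= (t ^+ 2) ^+ 'C(#|I|, 2) by rewrite !exprn_ge0.
apply: (@le_trans _ _ (\sum_(S2 : {set T} | #|S2| == s)
   \sum_(I : {set T} | (I \subset S1) && (I \subset S2))
     (t ^+ 2) ^+ 'C(#|I|, 2))).
  (* The intersection is one of the admissible [I], and the other terms are nonnegative. *)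
  apply: ler_sum => S2 _; rewrite (bigD1 (S1 :&: S2)) /=; last first.
    by rewrite finset.subsetIl finset.subsetIr.
  by rewrite lerDl sumr_ge0.
rewrite (exchange_big_dep (fun I : {set T} => I \subset S1)) /=; last first.
  by move=> ? ? _ /andP[].
have -> : (1 + a) ^+ s = \sum_(I : {set T} | I \subset S1) a ^+ #|I|.
  by rewrite sum_subset_expr_card c1.
rewrite mulr_sumr; apply: ler_sum => I IS.
have Is : (#|I| <= s)%N by rewrite -c1 subset_leq_card.
rewrite sumr_const -[leLHS]mulr_natr expr_bin2; set c := (X in _ * X%:R <= _).
have cnt : (c <= 'C(#|T| - #|I|, s - #|I|))%N.
  apply: leq_trans (card_supersets T I s); apply: subset_leq_card.
  by apply/fintype.subsetP => S2; rewrite !inE => /and3P[-> _ ->].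
have ratio : c%:R <= 'C(#|T|, s)%:R * (s%:R / n) ^+ #|I|.
  rewrite expr_div_n mulrA ler_pdivlMr ?exprn_gt0 // -!natrX -!natrM ler_nat.
  by rewrite (leq_trans _ (bin_sub_le _ _ _ Is sn)) // leq_mul2r cnt orbT.
(* Freeing the inner exponent from [I] lets each [I] contribute a pure power [a ^+ #|I|]. *)
have tle : (t ^+ #|I|.-1) ^+ #|I| <= (t ^+ s.-1) ^+ #|I|.
  by rewrite lerXn2r ?nnegrE ?exprn_ge0 // ler_weXn2l //; lia.
apply: le_trans (ler_pM _ _ tle ratio) _; rewrite ?exprn_ge0 //.
by rewrite mulrCA -exprMn /a mulrA [t ^+ _ * _]mulrC.
Qed.

Let second_moment :
  \sum_(G : sgraph T) gnp_weight p G * X G ^+ 2 <= mu ^+ 2 * (1 + a) ^+ s.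
Proof.
rewrite (_ : mu ^+ 2 * (1 + a) ^+ s =
  'C(#|T|, s)%:R
  * (q ^+ N * q ^+ N * ('C(#|T|, s)%:R * (1 + a) ^+ s))); last first.
  by rewrite /mu; ring.
rewrite -sum_card_const.
under eq_bigr do rewrite expr2 mulr_suml mulr_sumr.
rewrite exchange_big /=; apply: ler_sum => S1 /eqP c1.
under eq_bigr do rewrite mulr_sumr mulr_sumr.
rewrite exchange_big /=.
under eq_bigr => S2 /eqP c2 do rewrite sum_freeM //.
by rewrite -mulr_sumr ler_wpM2l ?sum_overlap // mulr_ge0 // exprn_ge0 // ltW.
Qed.

(** Chebyshev's inequality: on the event no s-set is independent, so [X = 0] and [(X / mu - 1) ^+ 2]
    equals 1; its mean is the relative variance. *)
Lemma alphak_lower_tail_moment :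
  gnp_prob p (fun G : sgraph T => (alphak k G < s)%N) <= (1 + a) ^+ s - 1.
Proof.
have mu0 : 0 < mu by rewrite mulr_gt0 ?exprn_gt0 // ltr0n bin_gt0.
pose F G := (X G / mu - 1) ^+ 2.
apply: (le_trans (markov_gnp _ _ _ hp _ F _ _)) => [G|G|].
- exact: sqr_ge0.
- move=> ak; suff X0 : X G = 0 by rewrite /F X0 mul0r sub0r sqrrN expr1n.
  apply: big1 => S /eqP Ss; rewrite /free expr0n cards_eq0.
  case: eqP => // /(kindep_no_edges T k) /alphak_ge; rewrite Ss leqNgt.
  by rewrite ak.
- rewrite /F.
  have -> : \sum_(G : sgraph T) gnp_weight p G * (X G / mu - 1) ^+ 2
    = (\sum_(G : sgraph T) gnp_weight p G * X G ^+ 2) / mu ^+ 2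
      - (2 / mu) * (\sum_(G : sgraph T) gnp_weight p G * X G)
      + \sum_(G : sgraph T) gnp_weight p G.
    rewrite mulr_suml mulr_sumr -sumrB -big_split; apply: eq_bigr => G _ /=.
    by field; rewrite gt_eqF.
  rewrite first_moment gnp_prob_total divfK ?gt_eqF //.
  have : (\sum_(G : sgraph T) gnp_weight p G * X G ^+ 2) / mu ^+ 2
      <= (1 + a) ^+ s.
    by rewrite ler_pdivrMr ?exprn_gt0 // mulrC.
  lra.
Qed.

End SecondMoment.

(** With [r = s a], the bound is trivial for [r >= 1 / 2]; otherwise
    [(1 + a) ^+ s - 1 <= r / (1 - r) <= 2 r]. *)
Lemma alphak_lower_tail (t : R) : 1 <= t -> t ^+ 2 = (1 - p)^-1 -> (0 < s)%N ->
  (0 < #|T|)%N ->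
  gnp_prob p (fun G : sgraph T => (alphak k G < s)%N)
  <= 2 * (s%:R ^+ 2 * t ^+ s.-1 / #|T|%:R).
Proof.
move=> t1 tp s0 T0; set r := _ / _.
have n0 : 0 < #|T|%:R :> R by rewrite ltr0n.
have [r2|r2] := lerP (1 / 2) r.
  by apply: le_trans (gnp_prob_le1 _ _ _ hp _) _; lra.
have t0 : 0 <= t by apply: le_trans t1.
(* A size above [#|T|] would force [r >= 1], as the numerator is at least [s ^+ 2]. *)
have sn : (s <= #|T|)%N.
  rewrite leqNgt; apply/negP => ns.
  suff : 1 <= r by lra.
  rewrite ler_pdivlMr // mul1r -[leLHS]mulr1 ler_pM ?exprn_ege1 //.
  by rewrite -natrX ler_nat; nia.
apply: le_trans (alphak_lower_tail_moment _ t1 tp sn s0) _.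
set a := s%:R * _ / _.
have a0 : 0 <= a by rewrite divr_ge0 ?mulr_ge0 ?exprn_ge0 // ltW.
have ra : r = s%:R * a by rewrite /r /a; ring.
have r0 : 0 <= r by rewrite ra mulr_ge0.
have := expr1D_mulB_le1 _ a s a0; rewrite -ra.
have : 0 <= (1 + a) ^+ s by rewrite exprn_ge0 //; lra.
set u := (1 + a) ^+ s => u0 ur.
by nra.
Qed.

End AlphakBounds.

(** * Elementary estimates for binomials, exponentials and logarithms *)

Lemma bin_le_expn (n s : nat) : ('C(n, s) <= n ^ s)%N.
Proof.
elim: s => [|s IH]; first by rewrite bin0.
rewrite expnS (@leq_trans (s.+1 * 'C(n, s.+1))) ?leq_pmull // -mul_bin_diag.
by rewrite leq_mul2l (leq_trans _ IH) ?orbT // leq_bin2l ?leq_pred.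
Qed.

(** Weakens exponential decay in [ln n] to the form [A / (1 + c * ln n)] shared by both tails. *)
Lemma expRN_le (R : realType) (x : R) : 0 <= x -> expR (- x) <= (1 + x)^-1.
Proof.
move=> x0; rewrite expRN lef_pV2 ?posrE ?expR_gt0 ?expR_ge1Dx //.
by rewrite ltr_wpDr.
Qed.

Lemma ln_nat_ge0 (R : realType) (n : nat) : 0 <= ln n%:R :> R.
Proof.
by case: n => [|n]; [rewrite ln0|rewrite ln_ge0 // ler1n].
Qed.

Lemma expR_ln_nat (R : realType) (n : nat) :
  (0 < n)%N -> expR (ln n%:R) = n%:R :> R.
Proof. by move=> n0; rewrite lnK // posrE ltr0n. Qed.

Lemma near_div_ln_le (R : realType) (A c d : R) : 0 <= A -> 0 < c -> 0 < d ->
  \forall n \near \oo%classic, A / (1 + c * ln n%:R) <= d.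
Proof.
move=> A0 c0 d0.
have := @cvgr_idn R => /cvgryPge /(_ (expR (A / (c * d)))).
apply: filterS => n nA.
have n0 : (0 < n)%N by rewrite -(ltr0n R) (lt_le_trans _ nA) ?expR_gt0.
have lnA : A / (c * d) <= ln n%:R by rewrite -ler_expR expR_ln_nat.
have den : 0 < 1 + c * ln n%:R.
  by rewrite ltr_wpDr // mulr_ge0 ?ln_nat_ge0 // ltW.
rewrite ler_pdivrMr //; move: lnA; rewrite ler_pdivrMr ?mulr_gt0 //.
nra.
Qed.

(** * Tail bounds at sizes proportional to the logarithm *)

Section Asymptotics.
Variables (R : realType) (p : R) (k : nat).
Hypothesis hp : 0 < p < 1.

Let beta : R := ln (1 / (1 - p)).

Let expbeta : expR beta = (1 - p)^-1.
Proof.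
case/andP: hp => p0 p1.
by rewrite /beta lnK ?posrE div1r // invr_gt0; lra.
Qed.

Let beta0 : 0 < beta.
Proof.
case/andP: hp => p0 p1.
by rewrite -expR_gt1 expbeta invf_gt1; lra.
Qed.

Lemma alphak_upper_tail_log (eps : R) : 0 < eps ->
  exists A c : R, [/\ 0 <= A, 0 < c & forall n : nat, (1 < n)%N ->
    gnp_prob p (fun G : sgraph 'I_n =>
      2 + eps < (alphak k G)%:R / logb (1 / (1 - p)) n%:R)
    <= A / (1 + c * ln n%:R)].
Proof.
move=> e0; case/andP: (hp) => p0 p1.
(* zeta > 0 is slightly below beta / 2: the edge weight x is chosen so that
   p x + (1 - p) = expR (- 2 zeta) is only slightly above 1 - p. *)
pose zeta : R := beta / (2 + eps / 2).
pose y : R := expR (- zeta) ^+ 2.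
pose x : R := (y - (1 - p)) / p.
(* Chosen so that [(2 + eps) / (2 + eps / 2) = 1 + c]. *)
pose c : R := eps / (4 + eps).
have zeta0 : 0 < zeta by rewrite divr_gt0 //; lra.
have zetac : zeta * ((2 + eps) / beta) = 1 + c.
  by rewrite /zeta /c; field; rewrite !gt_eqF //; lra.
have c0 : 0 < c by rewrite divr_gt0 //; lra.
have y1 : y < 1.
  by rewrite /y -expRM_natl -[ltRHS]expR0 ltr_expR; lra.
have yq : 1 - p < y.
  rewrite -[ltLHS]invrK -expbeta -expRN /y -expRM_natl ltr_expR.
  rewrite mulrN ltrN2 /zeta mulrA ltr_pdivrMr; last by lra.
  by rewrite mulrC ltr_pM2l //; lra.
have x0 : 0 < x by rewrite divr_gt0 //; lra.
have x1 : x <= 1 by rewrite ler_pdivrMr //; lra.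
have yx : p * x + (1 - p) = y by rewrite /x mulrC divfK ?subrK // gt_eqF.
(* The factor [expR zeta] pays for rounding the size threshold down to [m]; [x ^+ k] is the Markov
   denominator per vertex. *)
exists (expR zeta / x ^+ k), c; split=> //.
  by rewrite divr_ge0 ?expR_ge0 ?exprn_ge0 // ltW.
move=> n n1; set u := ln n%:R.
have n0 : (0 < n)%N by lia.
have u0 : 0 < u by rewrite ln_gt0 // ltr1n.
pose X := (2 + eps) * (u / beta).
have X0 : 0 <= X by rewrite mulr_ge0 ?divr_ge0 ?(ltW u0) ?(ltW beta0) //; lra.
have /andP[sX Xs] := truncn_itv X0; set m := Num.trunc X in sX Xs.
(* The tail bound at size [m.+1] is at most [B ^+ m.+1], hence at most [B] if [B < 1]; if [B >= 1]
   there is nothing to prove. *)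
pose B : R := n%:R * expR (- zeta) ^+ m / x ^+ k.
have B0 : 0 <= B by rewrite divr_ge0 ?mulr_ge0 ?exprn_ge0 ?expR_ge0 // ltW.
apply: (@le_trans _ _ B).
  have [B1|B1] := lerP 1 B; first exact: le_trans (gnp_prob_le1 _ _ _ hp _) B1.
  apply: (@le_trans _ _ (B ^+ m.+1)); last first.
    by rewrite -[leRHS]expr1 ler_wiXn2l // ltW.
  apply: (@le_trans _ _
      (gnp_prob p (fun G : sgraph 'I_n => (m.+1 <= alphak k G)%N))).
    apply: (gnp_prob_mono _ _ _ hp) => G aG.
    rewrite -(ltr_nat R); apply: le_lt_trans sX _.
    by move: aG; rewrite /logb ltr_pdivlMr // divr_gt0.
  apply: (le_trans (alphak_upper_tail R p 'I_n k m.+1 hp x _)).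
    by rewrite x0.
  rewrite yx card_ord expr_bin2 /=.
  have -> : B ^+ m.+1
      = n%:R ^+ m.+1 * ((expR (- zeta) ^+ m) ^+ m.+1 / x ^+ (k * m.+1)).
    by rewrite /B 2!exprMn exprVn [x ^+ (k * _)]exprM mulrA.
  rewrite ler_wpM2r ?divr_ge0 ?exprn_ge0 ?expR_ge0 ?(ltW x0) //.
  by rewrite -natrX ler_nat bin_le_expn.
rewrite [leRHS]mulrAC.
rewrite /B ler_wpM2r ?invr_ge0 ?exprn_ge0 ?(ltW x0) //.
have cu : 0 <= c * u by rewrite mulr_ge0 ?ltW.
apply: le_trans (ler_wpM2l (expR_ge0 _) (expRN_le _ _ cu)).
rewrite -(expR_ln_nat R n n0) -/u -expRM_natl -!expRD ler_expR.
have : zeta * X <= zeta * (m%:R + 1) by rewrite ler_pM2l // natr1 ltW.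
have -> : zeta * X = (1 + c) * u by rewrite -zetac /X; ring.
lra.
Qed.

Lemma alphak_lower_tail_log (eps : R) : 0 < eps < 2 ->
  exists A c : R, [/\ 0 <= A, 0 < c & forall n : nat, (1 < n)%N ->
    gnp_prob p (fun G : sgraph 'I_n =>
      (alphak k G)%:R / logb (1 / (1 - p)) n%:R < 2 - eps)
    <= A / (1 + c * ln n%:R)].
Proof.
move=> /andP[e0 e2].
pose t : R := expR (beta / 2).
have t1 : 1 <= t by rewrite -expR0 ler_expR divr_ge0 // ltW.
have tp : t ^+ 2 = (1 - p)^-1.
  (* Next, [c] is set so that [t ^+ m / n], at most [expR (- (eps / 2) * u)], gives three factors
     [1 / (1 + c * u)]: two absorb the square of the size and one remains. *)
  by rewrite -expbeta -expRM_natl; congr expR; field.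
pose c : R := eps / 6.
have c0 : 0 < c by rewrite divr_gt0.
(* Makes [M * (1 + c * u)] dominate [2 * (u / beta) + 1], a bound for the size [m.+1]. *)
pose M : R := 1 + 2 / (beta * c).
have M0 : 0 <= M by rewrite addr_ge0 ?divr_ge0 // ltW // mulr_gt0.
exists (2 * M ^+ 2), c; split=> //; first by rewrite mulr_ge0 ?sqr_ge0.
move=> n n1; set u := ln n%:R.
have n0 : (0 < n)%N by lia.
have u0 : 0 < u by rewrite ln_gt0 // ltr1n.
pose X := (2 - eps) * (u / beta).
have X0 : 0 <= X by rewrite mulr_ge0 ?divr_ge0 ?(ltW u0) ?(ltW beta0) //; lra.
have /andP[sX Xs] := truncn_itv X0; set m := Num.trunc X in sX Xs.
(* At size [m.+1] the exponent of [t] is [m <= X], so rounding costs nothing there. *)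
apply: (@le_trans _ _
    (gnp_prob p (fun G : sgraph 'I_n => (alphak k G < m.+1)%N))).
  apply: (gnp_prob_mono _ _ _ hp) => G aG.
  rewrite -(ltr_nat R); apply: lt_trans _ Xs.
  by move: aG; rewrite /logb ltr_pdivrMr // divr_gt0.
apply: (le_trans (alphak_lower_tail R p 'I_n k m.+1 hp t t1 tp _ _)) => //.
  by rewrite card_ord.
rewrite card_ord -[leRHS]mulrA ler_wpM2l // -[leLHS]mulrA.
have v0 : 0 < 1 + c * u by rewrite addr_gt0 // mulr_gt0.
have sM : m.+1%:R <= M * (1 + c * u).
  rewrite -natr1; apply: (@le_trans _ _ (2 * (u / beta) + 1)).
    rewrite lerD2r (le_trans sX) // ler_wpM2r //; last by lra.
    by rewrite divr_ge0 ?ltW.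
  have -> : M * (1 + c * u) = 2 * (u / beta) + 1 + (c * u + 2 / (beta * c)).
    by rewrite /M; field; rewrite !gt_eqF.
  by rewrite lerDl addr_ge0 ?divr_ge0 ?mulr_ge0 // ltW.
have tm : t ^+ m / n%:R <= (1 + c * u) ^- 3.
  have cu : 0 <= c * u by rewrite mulr_ge0 ?ltW.
  rewrite -exprVn; apply: (@le_trans _ _ (expR (- (c * u)) ^+ 3)); last first.
    by rewrite lerXn2r ?nnegrE ?expR_ge0 ?invr_ge0 ?(ltW v0) // expRN_le.
  rewrite -(expR_ln_nat R n n0) -/u -expRN -!expRM_natl -expRD ler_expR.
  have : m%:R * (beta / 2) <= X * (beta / 2).
    by rewrite ler_wpM2r // divr_ge0 // ltW.
  have -> : X * (beta / 2) = (1 - eps / 2) * u.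
    by rewrite /X; field; rewrite gt_eqF.
  by rewrite /c; lra.
have -> : M ^+ 2 / (1 + c * u) = (M * (1 + c * u)) ^+ 2 / (1 + c * u) ^+ 3.
  by field; rewrite gt_eqF.
apply: ler_pM => //; rewrite ?exprn_ge0 //.
  by rewrite divr_ge0 // exprn_ge0 // (le_trans _ t1).
by rewrite lerXn2r ?nnegrE // mulr_ge0 // ltW.
Qed.

End Asymptotics.

(** * Convergence of the probability to 1 *)

Local Open Scope classical_set_scope.

Theorem theorem3 (R : realType) (p : R) (k : nat)
    (hp : 0 < p < 1) (hk : (1 <= k)%N) :
  forall eps : R, 0 < eps ->
    (fun n : nat =>
       gnp_prob p (fun G : sgraph 'I_n =>
         `| (alphak k G)%:R / logb (1 / (1 - p)) n%:R - 2 | <= eps))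
      @ \oo --> (1 : R).
Proof.
move=> eps e0; apply/cvgrPdist_le => d d0.
(* The lower tail bound asks for a tolerance below 2; shrinking it only enlarges the lower bad
   event. *)
pose e := Num.min eps 1.
have e2 : 0 < e < 2.
  by rewrite lt_min e0 ltr01 gt_min ltr1n orbT.
have ee : e <= eps by rewrite ge_min lexx.
have [A1 [c1 [A10 c10 up]]] := alphak_upper_tail_log R p k hp eps e0.
have [A2 [c2 [A20 c20 low]]] := alphak_lower_tail_log R p k hp e e2.
have d2 : 0 < d / 2 by rewrite divr_gt0.
near=> n.
have n1 : (1 < n)%N by near: n; exact: nbhs_infty_gt.
have b1 : A1 / (1 + c1 * ln n%:R) <= d / 2 by near: n; exact: near_div_ln_le.
have b2 : A2 / (1 + c2 * ln n%:R) <= d / 2 by near: n; exact: near_div_ln_le.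
set good := fun G : sgraph 'I_n => _.
(* The distance to 1 is the probability of the complement, which the two tails cover. *)
rewrite -(gnp_probC _ p _ good) addrAC subrr add0r ger0_norm ?gnp_prob_ge0 //.
rewrite [leRHS]splitr; apply: le_trans _ (lerD b1 b2).
apply: le_trans _ (lerD (up n n1) (low n n1)).
apply: (gnp_prob_leU _ _ _ hp) => G; rewrite /= /good -ltNge.
set z := _ / _ => nz; case: (ltP (2 + eps) z) => //= z2; rewrite ltNge.
by apply: contraL nz => z3; rewrite -leNgt ler_norml; apply/andP; split; lra.
Unshelve. all: by end_near.
Qed.
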